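(* Let $\Omega$ be a set and let $\mathcal{F}_1,\mathcal{F}_2,\ldots$ be coherent cones of real-valued functions on $\Omega$ (the parameters of the protocol of independently priced trials). Suppose that $E\subseteq\Omega^\infty$ is a tail event. Then $E$ is certain, impossible, or fully uncertain; that is, $\underline{\mathbb{P}}(E)=1$, or $\overline{\mathbb{P}}(E)=0$, or both $\underline{\mathbb{P}}(E)=0$ and $\overline{\mathbb{P}}(E)=1$.
   Context: A coherent cone on $\Omega$ is a non-empty set $\mathcal{F}$ of real-valued functions on $\Omega$ such that: (1) $F_1,F_2\in\mathcal{F}$ implies $F_1+F_2\in\mathcal{F}$; (2) $c\ge 0$ and $F\in\mathcal{F}$ imply $cF\in\mathcal{F}$; (3) there is no $F\in\mathcal{F}$ with $F(\omega)>0$ for all $\omega\in\Omega$. Protocol of independently priced trials, with parameters $\Omega$ and coherent cones $\mathcal{F}_1,\mathcal{F}_2,\ldots$: Skeptic's initial capital is $\mathcal{K}_0=1$; on each trial $n=1,2,\ldots$ Skeptic announces $F_n\in\mathcal{F}_n$, then Reality announces $\omega_n\in\Omega$, and $\mathcal{K}_n:=\mathcal{K}_{n-1}+F_n(\omega_n)$. A strategy for Skeptic specifies, for each $n\ge 1$, the move $F_n\in\mathcal{F}_n$ as a function of Reality's preceding moves $\omega_1\ldots\omega_{n-1}$. Given a strategy, $\mathcal{K}_n$ is a function of $\omega_1\ldots\omega_n$. The strategy is prudent if $\mathcal{K}_n(\omega_1\ldots\omega_n)\ge 0$ for all $\omega_1\omega_2\ldots\in\Omega^\infty$ and all $n$.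 $\Omega^\infty$ is the set of all infinite sequences $\omega_1\omega_2\ldots$ of elements of $\Omega$; an event is an arbitrary subset $E$ of $\Omega^\infty$ (no measurability is required). The upper probability $\overline{\mathbb{P}}(E)$ is the infimum of all $\epsilon>0$ such that Skeptic has a prudent strategy for which $\sup_{n=1,2,\ldots}\mathcal{K}_n(\omega_1\ldots\omega_n)\ge 1/\epsilon$ for all $\omega_1\omega_2\ldots\in E$. The lower probability is $\underline{\mathbb{P}}(E):=1-\overline{\mathbb{P}}(E^c)$, where $E^c=\Omega^\infty\setminus E$. $E$ is certain if $\underline{\mathbb{P}}(E)=1$, impossible if $\overline{\mathbb{P}}(E)=0$, and fully uncertain if $\underline{\mathbb{P}}(E)=0$ and $\overline{\mathbb{P}}(E)=1$. $E$ is a tail event if any sequence in $\Omega^\infty$ that agrees from some point onwards with a sequence in $E$ is also in $E$; i.e., whenever $\omega_n=\omega_n'$ for all but finitely many $n$, the sequences $\omega_1\omega_2\ldots$ and $\omega_1'\omega_2'\ldots$ are either both in $E$ or both not in $E$. *)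

(* Defs.v *)
From mathcomp Require Import all_boot all_order all_algebra.
From mathcomp Require Import all_classical all_reals all_analysis.

Set Implicit Arguments.
Unset Strict Implicit.
Unset Printing Implicit Defensive.

Import Order.TTheory GRing.Theory Num.Theory.

Local Open Scope classical_set_scope.
Local Open Scope ring_scope.

Record coherent_cone (R : realType) (Omega : Type) (F : set (Omega -> R)) :
  Prop := CoherentCone {
  coherent_cone_nonempty : F !=set0;
  coherent_cone_add : forall f g, F f -> F g -> F (fun w => f w + g w);
  coherent_cone_scale : forall c f, 0 <= c -> F f -> F (fun w => c * f w);
  coherent_cone_coherent : ~ exists2 f, F f & forall w, 0 < f w
}.

(* Trials are numbered from 0: [F n] is the cone of the (n+1)-st trial and,
   for w : nat -> Omega, [w n] is Reality's move on that trial.  A strategy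
   maps the finite sequence of Reality's preceding moves to Skeptic's next
   move; the length of that sequence determines the trial. *)
Definition strategy (R : realType) (Omega : Type)
    (F : nat -> set (Omega -> R)) (S : seq Omega -> Omega -> R) : Prop :=
  forall s : seq Omega, F (size s) (S s).

(* [capital S w n] is Skeptic's capital after n trials; [mkseq w n] is
   [:: w 0; ...; w n.-1]. *)
Fixpoint capital (R : realType) (Omega : Type) (S : seq Omega -> Omega -> R)
    (w : nat -> Omega) (n : nat) : R :=
  if n is m.+1 then capital S w m + S (mkseq w m) (w m) else 1.

Definition prudent (R : realType) (Omega : Type)
    (S : seq Omega -> Omega -> R) : Prop :=
  forall (w : nat -> Omega) (n : nat), 0 <= capital S w n.

(* The supremum may be infinite, hence is taken in \bar R. *)
Definition sup_capital (R : realType) (Omega : Type)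
    (S : seq Omega -> Omega -> R) (w : nat -> Omega) : \bar R :=
  ereal_sup [set (capital S w n)%:E | n in [set n | (1 <= n)%N]].

Definition upper_prob_set (R : realType) (Omega : Type)
    (F : nat -> set (Omega -> R)) (E : set (nat -> Omega)) : set R :=
  [set e | 0 < e /\ exists S : seq Omega -> Omega -> R,
     [/\ strategy F S, prudent S &
         forall w, E w -> ((e^-1)%:E <= sup_capital S w)%E]].

Definition upper_prob (R : realType) (Omega : Type)
    (F : nat -> set (Omega -> R)) (E : set (nat -> Omega)) : R :=
  inf (upper_prob_set F E).

Definition lower_prob (R : realType) (Omega : Type)
    (F : nat -> set (Omega -> R)) (E : set (nat -> Omega)) : R :=
  1 - upper_prob F (~` E).

Definition certain (R : realType) (Omega : Type)
    (F : nat -> set (Omega -> R)) (E : set (nat -> Omega)) : Prop :=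
  lower_prob F E = 1.

Definition impossible (R : realType) (Omega : Type)
    (F : nat -> set (Omega -> R)) (E : set (nat -> Omega)) : Prop :=
  upper_prob F E = 0.

Definition fully_uncertain (R : realType) (Omega : Type)
    (F : nat -> set (Omega -> R)) (E : set (nat -> Omega)) : Prop :=
  lower_prob F E = 0 /\ upper_prob F E = 1.

Definition tail_event (Omega : Type) (E : set (nat -> Omega)) : Prop :=
  forall w w' : nat -> Omega,
    (exists N, forall n, (N <= n)%N -> w n = w' n) -> E w -> E w'.

(* For coherent cones the infimum in [upper_prob] is a genuine one, never the
   default value of [inf]. *)
Lemma has_inf_upper_prob_set (R : realType) (Omega : Type)
    (F : nat -> set (Omega -> R)) (E : set (nat -> Omega)) :
  (forall n, coherent_cone (F n)) -> has_inf (upper_prob_set F E).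
Proof.
move=> cF; split; last by exists 0 => e [/ltW].
have F0 n : F n (fun=> 0).
  have [f Ff] := coherent_cone_nonempty (cF n).
  have := coherent_cone_scale (cF n) (lexx 0) Ff.
  by congr (F n _); apply/funext => w; rewrite mul0r.
have K1 (w : nat -> Omega) n : capital (fun _ _ => 0 : R) w n = 1.
  by elim: n => //= n ->; rewrite addr0.
exists 1; split=> //; exists (fun _ _ => 0); split=> [s|w n|w _].
- exact: F0.
- by rewrite K1.
- by rewrite invr1; apply: ereal_sup_ubound; exists 1%N => //=; rewrite addr0.
Qed.

(* Main.v *)
Require Import Defs.
From mathcomp Require Import all_boot all_order all_algebra.
From mathcomp Require Import all_classical all_reals all_analysis.
From mathcomp Require Import lra.

(** This is a zero-one law: the upper probability of a tail event [E] is 0 or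
    1.  The theorem follows by applying it to [E] and to its complement, which
    is a tail event too.

    Suppose that the upper probability of [E] is smaller than 1.  Then some
    prudent strategy raises the capital from 1 to a level [c > 1] on the whole
    of [E].  It suffices to repeat this feat: if Skeptic can attain [c ^+ k] on
    [E] for every [k], the upper probability of [E] is 0.

    The difficulty is to restart a strategy [S] in the middle of the game, as
    the prices of later trials differ from those of the first ones.  Skeptic
    pretends that Reality's past moves were different.  Coherence prevents any
    move of Skeptic from being positive everywhere, so there is a path [p] along
    which the capital of [S] never exceeds 1 ([losing_path]).  When Skeptic
    restarts at time [t], the first [t] moves of Reality are replaced by those
    of [p] ([splice]).  Since [E] is a tail event, the modified sequence is
    still in [E], so [S] attains [c] on it; it cannot do so before time [t],
    and it starts from at most 1 at time [t], so that the gain from [t] onwards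
    is at least [c - 1].  Played with stakes multiplied by [a] from the moment
    when another strategy attains [a], it therefore leads to [a * c]
    ([attainableM]). *)

Set Implicit Arguments.
Unset Strict Implicit.
Unset Printing Implicit Defensive.

Import Order.TTheory GRing.Theory Num.Theory.
Import numFieldNormedType.Exports.

Local Open Scope classical_set_scope.
Local Open Scope ring_scope.

(** * Attainable levels of capital *)

(** Unlike in [sup_capital], the level has to be reached at a definite time:
    this is when Skeptic can switch to another strategy. *)
Definition attainable (R : realType) (Omega : Type)
    (F : nat -> set (Omega -> R)) (E : set (nat -> Omega)) (a : R) : Prop :=
  exists S : seq Omega -> Omega -> R,
    [/\ strategy F S, prudent S &
        forall w, E w -> exists2 n, (1 <= n)%N & a <= capital S w n].

Definition splice (Omega : Type) (p w : nat -> Omega) (t : nat) : nat -> Omega :=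
  fun i => if (i < t)%N then p i else w i.

Lemma eq_mkseq_lt (T : Type) (w w' : nat -> T) (n : nat) :
  (forall i, (i < n)%N -> w i = w' i) -> mkseq w n = mkseq w' n.
Proof.
move=> ww'; apply/eq_in_map => i; rewrite mem_iota add0n => /andP[_].
exact: ww'.
Qed.

Lemma eq_capital_lt (R : realType) (Omega : Type)
    (S : seq Omega -> Omega -> R) (w w' : nat -> Omega) (n : nat) :
  (forall i, (i < n)%N -> w i = w' i) -> capital S w n = capital S w' n.
Proof.
elim: n => //= n IH ww'; rewrite IH; last by move=> i /ltnW /ww'.
rewrite ww' // (@eq_mkseq_lt _ w w') // => i /ltnW; exact: ww'.
Qed.

Lemma attainable_upper_prob_set (R : realType) (Omega : Type)
    (F : nat -> set (Omega -> R)) (E : set (nat -> Omega)) (a : R) :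
  0 < a -> attainable F E a -> upper_prob_set F E a^-1.
Proof.
move=> a0 [S [FS pS aS]]; split; first by rewrite invr_gt0.
exists S; split=> // w /aS[n n1 an]; rewrite invrK.
apply: (@le_trans _ _ (capital S w n)%:E); first by rewrite lee_fin.
by apply: ereal_sup_ubound; exists n.
Qed.

Lemma upper_prob_set_attainable (R : realType) (Omega : Type)
    (F : nat -> set (Omega -> R)) (E : set (nat -> Omega)) (e a : R) :
  a < e^-1 -> upper_prob_set F E e -> attainable F E a.
Proof.
move=> ae [_ [S [FS pS eS]]]; exists S; split=> // w /eS eSw.
have : (a%:E < sup_capital S w)%E by apply: lt_le_trans eSw; rewrite lte_fin.
by move=> /ereal_sup_gt[_ [n n1 <-]]; rewrite lte_fin => /ltW; exists n.
Qed.

Lemma attainable1 (R : realType) (Omega : Type)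
    (F : nat -> set (Omega -> R)) (E : set (nat -> Omega)) :
  (forall n, coherent_cone (F n)) -> attainable F E 1.
Proof.
move=> cF; have K1 (w : nat -> Omega) n : capital (fun _ _ => 0 : R) w n = 1.
  by elim: n => //= n ->; rewrite addr0.
exists (fun _ _ => 0); split=> [s|w n|w _]; last by exists 1%N; rewrite ?K1.
- have [f Ff] := coherent_cone_nonempty (cF (size s)).
  have := coherent_cone_scale (cF (size s)) (lexx 0) Ff.
  by congr (F _ _); apply/funext => w; rewrite mul0r.
- by rewrite K1.
Qed.

(** By coherence, Reality can always answer a move of Skeptic with an outcome
    that brings no gain. *)
Lemma losing_path (R : realType) (Omega : Type) (F : nat -> set (Omega -> R))
    (S : seq Omega -> Omega -> R) :
  (forall n, coherent_cone (F n)) -> strategy F S ->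
  exists p : nat -> Omega, forall n, capital S p n <= 1.
Proof.
move=> cF FS.
have /choice[g g_le0] : forall s, exists x, S s x <= 0.
  move=> s; apply: contrapT => noloss.
  apply: (coherent_cone_coherent (cF (size s))); exists (S s) => // x.
  by rewrite ltNge; apply/negP => Sx; apply: noloss; exists x.
pose fix path n := if n is m.+1 then rcons (path m) (g (path m)) else [::].
pose p n := g (path n).
have pathE n : path n = mkseq p n.
  by elim: n => //= n IH; rewrite mkseqS -IH.
exists p; elim=> //= n IH; rewrite -pathE.
by rewrite -[leRHS]addr0 lerD // g_le0.
Qed.

(** * Switching to a restarted strategy *)

(** Replacing the moves before the switching time [t] by those of [p] lets [S2]
    resume at trial [t] with moves in the cones of the current trials.  The
    search for [t] returns [(size s).+1] when [S1] has not reached [a] within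
    [s].  The stake is [a], not the capital at time [t]: any excess over [a] is
    kept aside. *)
Definition switch (R : realType) (Omega : Type) (a : R) (p : nat -> Omega)
    (S1 S2 : seq Omega -> Omega -> R) (s : seq Omega) : Omega -> R :=
  let w := nth (p 0) s in
  let t := find (fun m => a <= capital S1 w m) (iota 0 (size s).+1) in
  if (t <= size s)%N then fun x => a * S2 (mkseq (splice p w t) (size s)) x
  else S1 s.

Section Switch.
Variables (R : realType) (Omega : Type) (a : R) (p : nat -> Omega).
Variables S1 S2 : seq Omega -> Omega -> R.

Local Notation S := (switch a p S1 S2).

Lemma strategy_switch (F : nat -> set (Omega -> R)) :
  (forall n, coherent_cone (F n)) -> 0 <= a ->
  strategy F S1 -> strategy F S2 -> strategy F S.
Proof.
move=> cF a0 FS1 FS2 s; rewrite /switch; case: ifP => _; last exact: FS1.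
apply: (coherent_cone_scale (cF _) a0).
set v := mkseq _ _.
by have := FS2 v; rewrite size_mkseq.
Qed.

Lemma find_hitting (w : nat -> Omega) (n : nat) :
  find (fun m => a <= capital S1 (nth (p 0) (mkseq w n)) m) (iota 0 n.+1) =
  find (fun m => a <= capital S1 w m) (iota 0 n.+1).
Proof.
apply: eq_in_find => m; rewrite mem_iota add0n ltnS => /andP[_ mn] /=.
congr (_ <= _); apply: eq_capital_lt => i im.
by rewrite nth_mkseq // (leq_trans im).
Qed.

Lemma switch_before (w : nat -> Omega) (n : nat) :
  (forall m, (m <= n)%N -> capital S1 w m < a) -> S (mkseq w n) = S1 (mkseq w n).
Proof.
move=> lt_a; rewrite /switch size_mkseq find_hitting.
case: ifP => // le_n.
have := @nth_find _ 0%N (fun m => a <= capital S1 w m) (iota 0 n.+1).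
rewrite has_find size_iota ltnS le_n => /(_ isT).
by rewrite nth_iota // add0n leNgt lt_a.
Qed.

Lemma switch_after (w : nat -> Omega) (t n : nat) :
  a <= capital S1 w t -> (forall m, (m < t)%N -> capital S1 w m < a) ->
  (t <= n)%N ->
  S (mkseq w n) = fun x => a * S2 (mkseq (splice p w t) n) x.
Proof.
move=> at_ lt_a tn; rewrite /switch size_mkseq find_hitting.
have -> : find (fun m => a <= capital S1 w m) (iota 0 n.+1) = t.
  have -> : n.+1 = (t + (n - t).+1)%N by rewrite addnS subnKC.
  rewrite iotaD find_cat size_iota add0n ifF; first by rewrite /= at_ addn0.
  apply/hasP => -[m]; rewrite mem_iota add0n => /andP[_ /lt_a].
  by rewrite ltNge => /negP.
rewrite tn; apply/funext => x; congr (_ * S2 _ _).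
apply: eq_mkseq_lt => i i_n; rewrite /splice; case: ifP => // _.
by rewrite nth_mkseq.
Qed.

Lemma capital_switch_before (w : nat -> Omega) (n : nat) :
  (forall m, (m < n)%N -> capital S1 w m < a) -> capital S w n = capital S1 w n.
Proof.
elim: n => //= n IH lt_a; rewrite IH; last by move=> m /ltnW /lt_a.
by rewrite switch_before.
Qed.

Lemma capital_switch_after (w : nat -> Omega) (t n : nat) :
  a <= capital S1 w t -> (forall m, (m < t)%N -> capital S1 w m < a) ->
  (t <= n)%N ->
  capital S w n = capital S1 w t +
    a * (capital S2 (splice p w t) n - capital S2 p t).
Proof.
move=> at_ lt_a /subnKC <-; elim: (n - t)%N => [|k IH].
  rewrite addn0 capital_switch_before //.
  rewrite (@eq_capital_lt _ _ S2 (splice p w t) p) ?subrr ?mulr0 ?addr0 //.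
  by move=> i it; rewrite /splice it.
rewrite addnS /= IH (switch_after at_ lt_a) ?leq_addr //.
have -> : splice p w t (t + k)%N = w (t + k)%N.
  by rewrite /splice ltnNge leq_addr.
lra.
Qed.

(** At time [t] the actual capital is at least [a], whereas [a] units of [S2]
    resumed after [p] are worth at most [a]; from then on both change by the
    same amounts. *)
Lemma capital_switch_ge (w : nat -> Omega) (t n : nat) :
  0 <= a -> (forall m, capital S2 p m <= 1) ->
  a <= capital S1 w t -> (forall m, (m < t)%N -> capital S1 w m < a) ->
  (t <= n)%N ->
  a * capital S2 (splice p w t) n <= capital S w n.
Proof.
move=> a0 p1 at_ lt_a tn; rewrite (capital_switch_after at_ lt_a tn).
have := ler_wpM2l a0 (p1 t); lra.
Qed.

Lemma prudent_switch :
  0 <= a -> (forall m, capital S2 p m <= 1) ->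
  prudent S1 -> prudent S2 -> prudent S.
Proof.
move=> a0 p1 pS1 pS2 w n.
have [hit|nohit] := pselect (exists m, (m <= n)%N && (a <= capital S1 w m)).
  case: (ex_minnP hit) => t /andP[tn at_] t_min.
  apply: le_trans (capital_switch_ge a0 p1 at_ _ tn).
    by rewrite mulr_ge0.
  move=> m mt; rewrite ltNge; apply: contraTN mt => am.
  rewrite -leqNgt; case: (leqP m n) => mn; first by rewrite t_min // mn.
  exact: leq_trans tn (ltnW mn).
rewrite capital_switch_before // => m mn; rewrite ltNge; apply/negP => am.
by apply: nohit; exists m; rewrite (ltnW mn).
Qed.

End Switch.

(** * The zero-one law *)

(** The condition [1 < b] ensures that the second strategy does not attain [b]
    on the fictitious past, where its capital is at most 1. *)
Lemma attainableM (R : realType) (Omega : Type) (F : nat -> set (Omega -> R))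
    (E : set (nat -> Omega)) (a b : R) :
  (forall n, coherent_cone (F n)) -> tail_event E -> 0 <= a -> 1 < b ->
  attainable F E a -> attainable F E b -> attainable F E (a * b).
Proof.
move=> cF tE a0 b1 [S1 [FS1 pS1 aS1]] [S2 [FS2 pS2 bS2]].
have [p p1] := losing_path cF FS2.
exists (switch a p S1 S2); split.
- exact: strategy_switch cF _ _ _.
- exact: prudent_switch.
move=> w Ew.
have hit : exists m, a <= capital S1 w m by have [m _] := aS1 w Ew; exists m.
case: (ex_minnP hit) => t at_ t_min.
have lt_a m : (m < t)%N -> capital S1 w m < a.
  by move=> mt; rewrite ltNge; apply: contraTN mt => /t_min; rewrite leqNgt.
have [n n1 bn] : exists2 n, (1 <= n)%N & b <= capital S2 (splice p w t) n.
  apply: bS2; apply: tE Ew; exists t => n tn.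
  by rewrite /splice ltnNge tn.
have tn : (t <= n)%N.
  rewrite leqNgt; apply/negP => nt; move: bn.
  rewrite (@eq_capital_lt _ _ S2 (splice p w t) p); last first.
    by move=> i i_n; rewrite /splice (ltn_trans i_n nt).
  by rewrite leNgt (le_lt_trans (p1 n) b1).
exists n => //; apply: le_trans (capital_switch_ge a0 p1 at_ lt_a tn).
exact: ler_wpM2l.
Qed.

Lemma upper_prob_le1 (R : realType) (Omega : Type)
    (F : nat -> set (Omega -> R)) (E : set (nat -> Omega)) :
  (forall n, coherent_cone (F n)) -> upper_prob F E <= 1.
Proof.
move=> cF; apply: ge_inf; first by case: (has_inf_upper_prob_set E cF).
rewrite -[1]invr1; apply: attainable_upper_prob_set => //; exact: attainable1.
Qed.

(** If some level above 1 is attainable, so are all its powers, which drives the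
    infimum down to 0. *)
Lemma upper_prob_tail (R : realType) (Omega : Type)
    (F : nat -> set (Omega -> R)) (E : set (nat -> Omega)) :
  (forall n, coherent_cone (F n)) -> tail_event E ->
  upper_prob F E = 0 \/ upper_prob F E = 1.
Proof.
move=> cF tE; have := upper_prob_le1 E cF.
rewrite le_eqVlt => /predU1P[->|]; [by right|move=> lt1; left].
have hinf := has_inf_upper_prob_set E cF.
have [e ee e1] : exists2 e, upper_prob_set F E e & e < 1 by apply: inf_lt lt1; case: hinf.
have e0 : 0 < e by case: ee.
have [c c1 ce] : exists2 c, 1 < c & c < e^-1.
  have le1 : 1 < e^-1 by rewrite invf_gt1.
  by exists ((1 + e^-1) / 2); lra.
have attc := upper_prob_set_attainable ce ee.
have c0 : 0 < c by exact: lt_trans c1.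
have attX k : attainable F E (c ^+ k).
  elim: k => [|k IH]; first by rewrite expr0; exact: attainable1.
  by rewrite exprSr; apply: attainableM => //; rewrite exprn_ge0 ?ltW.
have inf_le k : upper_prob F E <= c^-1 ^+ k.
  apply: ge_inf; first by case: hinf.
  by rewrite exprVn; apply: attainable_upper_prob_set => //; rewrite exprn_gt0.
apply/eqP; rewrite eq_le; apply/andP; split; last first.
  by apply: lb_le_inf; [case: hinf | move=> x [/ltW]].
have cvg0 : (c^-1 ^+ k) @[k --> \oo] --> (0 : R).
  by apply: cvg_expr; rewrite ger0_norm ?invr_ge0 ?ltW // invf_lt1.
by apply: (cvgr_to_ge cvg0); exact: nearW.
Qed.

Lemma tail_eventC (Omega : Type) (E : set (nat -> Omega)) :
  tail_event E -> tail_event (~` E).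
Proof.
move=> tE w w' [N ww'] nEw Ew'; apply: nEw; apply: tE Ew'.
by exists N => n /ww'.
Qed.

Theorem theorem1 (R : realType) (Omega : Type) (F : nat -> set (Omega -> R))
    (E : set (nat -> Omega)) :
  (forall n, coherent_cone (F n)) ->
  tail_event E ->
  certain F E \/ impossible F E \/ fully_uncertain F E.
Proof.
move=> cF tE; rewrite /certain /impossible /fully_uncertain /lower_prob.
have [->|->] := upper_prob_tail cF (tail_eventC tE); first by left; rewrite subr0.
by right; have [->|->] := upper_prob_tail cF tE; [left|right; rewrite subrr].
Qed.
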